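(* Let $A \mid B$ be an algebra extension and let $W := V_A(V_A(B))$ be the double centralizer of $B$ in $A$. If $A\mid B$ is a left D2 extension and $W \mid B$ is a separable extension, then $A \mid W$ is a weak left D2 extension. Likewise, if $A\mid B$ is a right D2 extension and $W\mid B$ is a separable extension, then $A\mid W$ is a weak right D2 extension.
   Context: Algebras are unital, associative (not necessarily commutative) over a commutative ground ring $K$. An algebra extension $A\mid B$ is a unit-preserving algebra homomorphism $B\to A$ (the homomorphism is suppressed in notation, and $A$ is a $B$-$B$-bimodule through it). $V_A(X)=\{a\in A : ax=xa \ \forall x\in X\}$ is the centralizer, where $V_A(B)$ means the centralizer of the image of $B$. The map $B\to A$ takes values in $W=V_A(V_A(B))$, giving the extension $W\mid B$; $A\mid W$ is the inclusion. The notation $X\oplus *\cong Y$ means $X$ is isomorphic to a direct summand of $Y$. $A\mid B$ is left D2 if, as $B$-$A$-bimodules, $A\otimes_B A\oplus *\cong A^N$ for some positive integer $N$; it is right D2 if this holds as $A$-$B$-bimodules. A separable extension $W\mid B$ is one for which the multiplication map $W\otimes_B W\to W$ is a split epimorphism of $W$-$W$-bimodules. For an extension $A\mid B$ put $R:=V_A(B)$ and $S:=\operatorname{End}({}_BA_B)$, the $B$-$B$-bimodule endomorphisms of $A$. $S$ is a left $R$-module by $(r\cdot\alpha)(x)=r\alpha(x)$ and a right $R$-module by $(\alpha\cdot r)(x)=\alpha(x)r$. $A\mid B$ is weak left D2 if ${}_RS$ is finitely generated projective and the $B$-$A$-bimodule homomorphism $$\Psi: A\otimes_B A\to \operatorname{Hom}({}_RS,{}_RA),\qquad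 \Psi(x\otimes y)(\alpha)=\alpha(x)y$$ is a split epimorphism of $B$-$A$-bimodules, where $(b\cdot G\cdot a)(\alpha)=bG(\alpha)a$. Oppositely, $A\mid B$ is weak right D2 if $S_R$ is finitely generated projective and the $A$-$B$-bimodule homomorphism $A\otimes_BA\to\operatorname{Hom}(S_R,A_R)$, $x\otimes y\mapsto(\alpha\mapsto x\alpha(y))$, is a split epimorphism of $A$-$B$-bimodules. (For the extension $A\mid W$ these definitions are applied with $W$ in place of $B$.) *)

(* Defs.v *)
From HB Require Import structures.
From mathcomp Require Import all_boot all_algebra.
From mathcomp Require Import boolp classical_sets functions.
From mathcomp Require Import freeg.

Set Implicit Arguments.
Unset Strict Implicit.
Unset Printing Implicit Defensive.

Import GRing.Theory.

Local Open Scope classical_set_scope.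
Local Open Scope ring_scope.
Local Open Scope quotient_scope.

#[local] Obligation Tactic := idtac.

(* The library's [algType K] requires 1 != 0. Here an algebra may be zero: a
   K-algebra is a ring with a ring morphism from K to its centre. *)
Record algebra (K : comPzRingType) := Algebra {
  alg_car :> pzRingType;
  alg_unit : {rmorphism K -> alg_car};
  alg_central : forall (k : K) (a : alg_car), alg_unit k * a = a * alg_unit k
}.

Definition alg_hom (K : comPzRingType) (B A : algebra K)
    (f : {rmorphism B -> A}) : Prop :=
  forall k : K, f (alg_unit B k) = alg_unit A k.

Record bimod (R S : pzRingType) := Bimod {
  bcar :> zmodType;
  lact : R -> bcar -> bcar;
  ract : bcar -> S -> bcar;
  lactA : forall r r' m, lact r (lact r' m) = lact (r * r') m;
  lact1 : forall m, lact 1 m = m;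
  lactDr : forall r m m', lact r (m + m') = lact r m + lact r m';
  lactDl : forall r r' m, lact (r + r') m = lact r m + lact r' m;
  ractA : forall s s' m, ract (ract m s) s' = ract m (s * s');
  ract1 : forall m, ract m 1 = m;
  ractDl : forall m m' s, ract (m + m') s = ract m s + ract m' s;
  ractDr : forall m s s', ract m (s + s') = ract m s + ract m s';
  lractA : forall r m s, lact r (ract m s) = ract (lact r m) s
}.

(* The underlying one-sided modules. Right S-modules are, as usual in MathComp,
   left modules over the converse ring [S^c]. *)
Definition left_mod (R S : pzRingType) (M : bimod R S) : Type := bcar M.
Definition right_mod (R S : pzRingType) (M : bimod R S) : Type := bcar M.

HB.instance Definition _ (R S : pzRingType) (M : bimod R S) :=
  GRing.Zmodule.on (left_mod M).
HB.instance Definition _ (R S : pzRingType) (M : bimod R S) :=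
  GRing.Zmodule_isLmodule.Build R (left_mod M)
    (@lactA _ _ M) (@lact1 _ _ M) (@lactDr _ _ M)
    (fun v a b => @lactDl _ _ M a b v).

HB.instance Definition _ (R S : pzRingType) (M : bimod R S) :=
  GRing.Zmodule.on (right_mod M).
HB.instance Definition _ (R S : pzRingType) (M : bimod R S) :=
  @GRing.Zmodule_isLmodule.Build S^c (right_mod M) (fun s m => ract m s)
    (fun a b v => @ractA _ _ M b a v) (@ract1 _ _ M)
    (fun s m m' => @ractDl _ _ M m m' s) (fun v a b => @ractDr _ _ M v a b).

Definition bimod_hom (R S : pzRingType) (M N : bimod R S) (h : M -> N) : Prop :=
  [/\ forall x y, h (x + y) = h x + h y,
      forall r x, h (lact r x) = lact r (h x)
    & forall x s, h (ract x s) = ract (h x) s].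

Definition bimod_iso (R S : pzRingType) (M N : bimod R S) : Prop :=
  exists2 h : M -> N, bimod_hom h & bijective h.

Definition split_epi (R S : pzRingType) (M N : bimod R S) (h : M -> N) : Prop :=
  bimod_hom h /\ exists2 s : N -> M, bimod_hom s & cancel s h.

Definition reg_bimod (A : pzRingType) : bimod A A :=
  @Bimod A A A (fun a x => a * x) (fun x a => x * a)
    (@mulrA A) (@mul1r A) (@mulrDr A) (fun r r' m => mulrDl r r' m)
    (fun s s' m => esym (mulrA m s s')) (@mulr1 A) (@mulrDl A)
    (fun m s s' => mulrDr m s s') (@mulrA A).

Program Definition res_bimod (R R' S S' : pzRingType) (f : {rmorphism R' -> R})
    (g : {rmorphism S' -> S}) (M : bimod R S) : bimod R' S' :=
  @Bimod R' S' M (fun r m => lact (f r) m) (fun m s => ract m (g s))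
    _ _ _ _ _ _ _ _ _.
Next Obligation. by move=> * /=; rewrite lactA rmorphM. Qed.
Next Obligation. by move=> * /=; rewrite rmorph1 lact1. Qed.
Next Obligation. by move=> * /=; rewrite lactDr. Qed.
Next Obligation. by move=> * /=; rewrite rmorphD lactDl. Qed.
Next Obligation. by move=> * /=; rewrite ractA rmorphM. Qed.
Next Obligation. by move=> * /=; rewrite rmorph1 ract1. Qed.
Next Obligation. by move=> * /=; rewrite ractDl. Qed.
Next Obligation. by move=> * /=; rewrite rmorphD ractDr. Qed.
Next Obligation. by move=> * /=; rewrite lractA. Qed.

Program Definition sum_bimod (R S : pzRingType) (M N : bimod R S) : bimod R S :=
  @Bimod R S (M * N)%type (fun r m => (lact r m.1, lact r m.2))
    (fun m s => (ract m.1 s, ract m.2 s)) _ _ _ _ _ _ _ _ _.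
Next Obligation. by move=> * /=; rewrite !lactA. Qed.
Next Obligation. by move=> R S M N [? ?] /=; rewrite !lact1. Qed.
Next Obligation. by move=> * /=; rewrite !lactDr. Qed.
Next Obligation. by move=> * /=; rewrite !lactDl. Qed.
Next Obligation. by move=> * /=; rewrite !ractA. Qed.
Next Obligation. by move=> R S M N [? ?] /=; rewrite !ract1. Qed.
Next Obligation. by move=> * /=; rewrite !ractDl. Qed.
Next Obligation. by move=> * /=; rewrite !ractDr. Qed.
Next Obligation. by move=> * /=; rewrite !lractA. Qed.

Program Definition pow_bimod (R S : pzRingType) (M : bimod R S) (n : nat) :
    bimod R S :=
  @Bimod R S {ffun 'I_n -> M} (fun r v => [ffun i => lact r (v i)])
    (fun v s => [ffun i => ract (v i) s]) _ _ _ _ _ _ _ _ _.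
Next Obligation. by move=> * /=; apply/ffunP=> i; rewrite !ffunE lactA. Qed.
Next Obligation. by move=> * /=; apply/ffunP=> i; rewrite !ffunE lact1. Qed.
Next Obligation. by move=> * /=; apply/ffunP=> i; rewrite !ffunE lactDr. Qed.
Next Obligation. by move=> * /=; apply/ffunP=> i; rewrite !ffunE lactDl. Qed.
Next Obligation. by move=> * /=; apply/ffunP=> i; rewrite !ffunE ractA. Qed.
Next Obligation. by move=> * /=; apply/ffunP=> i; rewrite !ffunE ract1. Qed.
Next Obligation. by move=> * /=; apply/ffunP=> i; rewrite !ffunE ractDl. Qed.
Next Obligation. by move=> * /=; apply/ffunP=> i; rewrite !ffunE ractDr. Qed.
Next Obligation. by move=> * /=; apply/ffunP=> i; rewrite !ffunE lractA. Qed.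

(* X (+) * ~ Y; with Y = A^N the two actions of a ground ring K
   agree on Y, so no K-symmetry has to be imposed on the complement. *)
Definition direct_summand (R S : pzRingType) (X Y : bimod R S) : Prop :=
  exists C : bimod R S, bimod_iso (sum_bimod X C) Y.

(* Free abelian group on M x N modulo the subgroup generated by the
   biadditivity and T-balancedness relations. *)
Section Tensor.
Context (R T S : pzRingType) (M : bimod R T) (N : bimod T S).

Definition tens_free : zmodType := {freeg (M * N)%type / int}.

Definition tens_gen (m : M) (n : N) : tens_free := [freeg [:: (1%:Z, (m, n))]].

Variant tens_rel : tens_free -> Prop :=
| TensRelDl m m' n :
    tens_rel (tens_gen (m + m') n - tens_gen m n - tens_gen m' n)
| TensRelDr m n n' :
    tens_rel (tens_gen m (n + n') - tens_gen m n - tens_gen m n')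
| TensRelA m t n :
    tens_rel (tens_gen (ract m t) n - tens_gen m (lact t n)).

Definition tens_ker : {pred tens_free} := fun z =>
  `[< forall P : zmodClosed tens_free, (forall u, tens_rel u -> u \in P) ->
      z \in P >].

Fact tens_ker_zmod_closed : zmod_closed tens_ker.
Proof.
split=> [|x y]; rewrite !unfold_in.
  by apply/asboolP=> P _; apply: rpred0.
move=> /asboolP xP /asboolP yP; apply/asboolP=> P relP.
by rewrite rpredB ?xP ?yP.
Qed.
HB.instance Definition _ :=
  GRing.isZmodClosed.Build tens_free tens_ker tens_ker_zmod_closed.

Definition tens : zmodType := Quotient.quot tens_ker.

Definition tens_pi (z : tens_free) : tens := \pi_(Quotient.quot tens_ker) z.

Definition tens_mk (m : M) (n : N) : tens := tens_pi (tens_gen m n).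

(* The additive map x (x) y |-> h x y; meaningful for balanced h only. *)
Definition tens_lift (P : zmodType) (h : M -> N -> P) (z : tens) : P :=
  fglift (fun p : (M * N)%type => h p.1 p.2 : zmodule P) (repr z).

Definition balanced (P : zmodType) (h : M -> N -> P) : Prop :=
  [/\ forall m m' n, h (m + m') n = h m n + h m' n,
      forall m n n', h m (n + n') = h m n + h m n'
    & forall m t n, h (ract m t) n = h m (lact t n)].

Lemma tens_piB z w : tens_pi (z - w) = tens_pi z - tens_pi w.
Proof. by rewrite /tens_pi !piE. Qed.

Lemma tens_pi0 : tens_pi 0 = 0.
Proof. by have := tens_piB 0 0; rewrite !subrr. Qed.

Lemma tens_piD z w : tens_pi (z + w) = tens_pi z + tens_pi w.
Proof.
have tN u : tens_pi (- u) = - tens_pi u.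
  by rewrite -[- u]add0r tens_piB tens_pi0 add0r.
by rewrite -{1}[w]opprK tens_piB tN opprK.
Qed.

Lemma tens_pi_rel z : tens_rel z -> tens_pi z = 0.
Proof.
move=> rz; rewrite -tens_pi0; apply/eqmodP; rewrite /= /Quotient.equiv subr0.
by rewrite unfold_in; apply/asboolP=> P; apply.
Qed.

Lemma tens_mkDl m m' n : tens_mk (m + m') n = tens_mk m n + tens_mk m' n.
Proof.
by apply/eqP; rewrite -subr_eq0 opprD addrA -!tens_piB (tens_pi_rel (TensRelDl _ _ _)).
Qed.

Lemma tens_mkDr m n n' : tens_mk m (n + n') = tens_mk m n + tens_mk m n'.
Proof.
by apply/eqP; rewrite -subr_eq0 opprD addrA -!tens_piB (tens_pi_rel (TensRelDr _ _ _)).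
Qed.

Lemma tens_mkA m t n : tens_mk (ract m t) n = tens_mk m (lact t n).
Proof.
by apply/eqP; rewrite -subr_eq0 -!tens_piB (tens_pi_rel (TensRelA _ _ _)).
Qed.

Lemma tens_ind (Q : tens -> Prop) :
    Q 0 -> (forall z w, Q z -> Q w -> Q (z - w)) ->
    (forall m n, Q (tens_mk m n)) ->
  forall z, Q z.
Proof.
move=> Q0 QB Qm z; rewrite -[z]reprK -/(tens_pi _).
have QN u : Q u -> Q (- u) by move=> Qu; rewrite -[- u]add0r; apply: QB.
have QD u v : Q u -> Q v -> Q (u + v).
  by move=> Qu Qv; rewrite -[v]opprK; apply: QB => //; apply: QN.
rewrite -[repr z]freeg_sumE; elim/big_ind: _ => [|u v Qu Qv|[m n] _].
- by rewrite tens_pi0.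
- by rewrite tens_piD; apply: QD.
set c := coeff _ _; clearbody c.
have Qpos k : Q (tens_pi [freeg [:: (k%:Z, (m, n))]]).
  elim: k => [|k IHk]; first by rewrite freegU0 tens_pi0.
  by rewrite intS -freegUD tens_piD; apply: QD => //; apply: Qm.
case: c => k //; rewrite NegzE -freegUN -[- _]add0r tens_piB tens_pi0.
by apply: QB.
Qed.

Section Lift.
Context (P : zmodType) (h : M -> N -> P) (hh : balanced h).

Let F (z : tens_free) : P :=
  fglift (fun p : (M * N)%type => h p.1 p.2 : zmodule P) z.

Let FB z w : F (z - w) = F z - F w.
Proof. exact: (@lift_is_additive _ _ (zmodule P)). Qed.

Let Fgen m n : F (tens_gen m n) = h m n.
Proof. by rewrite /F liftU scale1r. Qed.

Let F_tens_pi z : tens_lift h (tens_pi z) = F z.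
Proof.
pose kp : pred tens_free := fun u => F u == 0.
have kerP : zmod_closed kp.
  split=> [|u v]; rewrite !unfold_in /kp.
    by have := FB 0 0; rewrite !subrr => ->.
  by move=> /eqP u0 /eqP v0; rewrite FB u0 v0 subrr.
pose mixin := GRing.isZmodClosed.Build _ _ kerP.
pose ker : zmodClosed tens_free := HB.pack kp mixin.
suff : repr (tens_pi z) - z \in ker.
  by rewrite unfold_in /= /kp FB subr_eq0 => /eqP.
have : repr (tens_pi z) = z %[mod Quotient.quot tens_ker] by rewrite reprK.
move/eqmodP; rewrite /= /Quotient.equiv unfold_in => /asboolP/(_ ker); apply=> u.
case: hh => hDl hDr hA.
by case=> *; rewrite unfold_in /= /kp !FB !Fgen ?hDl ?hDr ?hA ?addrK ?subrr //
  addrAC ?addrK ?subrr // addrAC addrK subrr.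
Qed.

Lemma tens_liftE m n : tens_lift h (tens_mk m n) = h m n.
Proof. by rewrite F_tens_pi Fgen. Qed.

Lemma tens_liftB z w : tens_lift h (z - w) = tens_lift h z - tens_lift h w.
Proof.
rewrite -[z]reprK -[w]reprK -!/(tens_pi _) -tens_piB !F_tens_pi.
exact: FB.
Qed.

Lemma tens_lift0 : tens_lift h 0 = 0.
Proof. by have := tens_liftB 0 0; rewrite !subrr. Qed.

Lemma tens_liftD z w : tens_lift h (z + w) = tens_lift h z + tens_lift h w.
Proof.
have tN u : tens_lift h (- u) = - tens_lift h u.
  by rewrite -[- u]add0r tens_liftB tens_lift0 add0r.
by rewrite -{1}[w]opprK tens_liftB tN opprK.
Qed.

End Lift.

Lemma tens_ext (P : zmodType) (f g : tens -> P) :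
    (forall z w, f (z + w) = f z + f w) -> (forall z w, g (z + w) = g z + g w) ->
    (forall m n, f (tens_mk m n) = g (tens_mk m n)) ->
  f =1 g.
Proof.
move=> fD gD fg.
have f0 (k : tens -> P) : (forall z w, k (z + w) = k z + k w) ->
    k 0 = 0 /\ forall z w, k (z - w) = k z - k w.
  move=> kD; have k0 : k 0 = 0.
    by apply: (addrI (k 0)); rewrite -kD !addr0.
  split=> // z w; rewrite kD; congr (_ + _); apply: (addrI (k w)).
  by rewrite -kD !subrr.
have [[f00 fB] [g00 gB]] := (f0 f fD, f0 g gD).
by apply: tens_ind => [|z w zP wP|//]; rewrite ?f00 ?g00 // fB gB zP wP.
Qed.

Definition tens_lact (r : R) : tens -> tens :=
  tens_lift (fun m n => tens_mk (lact r m) n).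
Definition tens_ract (z : tens) (s : S) : tens :=
  tens_lift (fun m n => tens_mk m (ract n s)) z.

Fact balanced_lact r : balanced (fun m n => tens_mk (lact r m) n).
Proof.
by split=> *; rewrite ?lactDr ?tens_mkDl ?tens_mkDr ?lractA ?tens_mkA.
Qed.

Fact balanced_ract s : balanced (fun m n => tens_mk m (ract n s)).
Proof.
by split=> *; rewrite ?ractDl ?tens_mkDl ?tens_mkDr ?tens_mkA ?lractA.
Qed.

Lemma tens_lactE r m n : tens_lact r (tens_mk m n) = tens_mk (lact r m) n.
Proof. exact: tens_liftE (balanced_lact r) _ _. Qed.

Lemma tens_ractE m n s : tens_ract (tens_mk m n) s = tens_mk m (ract n s).
Proof. exact: tens_liftE (balanced_ract s) _ _. Qed.

Fact tens_lactD r z w : tens_lact r (z + w) = tens_lact r z + tens_lact r w.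
Proof. exact: tens_liftD (balanced_lact r) _ _. Qed.

Fact tens_ractD z w s : tens_ract (z + w) s = tens_ract z s + tens_ract w s.
Proof. exact: tens_liftD (balanced_ract s) _ _. Qed.

Program Definition tens_bimod : bimod R S :=
  @Bimod R S tens tens_lact tens_ract _ _ tens_lactD _ _ _ tens_ractD _ _.
Next Obligation.
move=> r r'; apply: tens_ext => [z w|z w|m n]; rewrite ?tens_lactD //.
by rewrite !tens_lactE lactA.
Qed.
Next Obligation.
by apply: tens_ext => [z w|z w|m n]; rewrite ?tens_lactD ?tens_lactE ?lact1.
Qed.
Next Obligation.
move=> r r'; apply: tens_ext => [z w|z w|m n]; rewrite ?tens_lactD //.
  by rewrite addrACA.
by rewrite !tens_lactE lactDl tens_mkDl.
Qed.
Next Obligation.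
move=> s s'; apply: tens_ext => [z w|z w|m n]; rewrite ?tens_ractD //.
by rewrite !tens_ractE ractA.
Qed.
Next Obligation.
by apply: tens_ext => [z w|z w|m n]; rewrite ?tens_ractD ?tens_ractE ?ract1.
Qed.
Next Obligation.
move=> z s s'; move: z; apply: tens_ext => [z w|z w|m n]; rewrite ?tens_ractD //.
  by rewrite addrACA.
by rewrite !tens_ractE ractDr tens_mkDr.
Qed.
Next Obligation.
move=> r z s; move: z; apply: tens_ext => [z w|z w|m n].
- by rewrite tens_ractD tens_lactD.
- by rewrite tens_lactD tens_ractD.
- by rewrite tens_ractE !tens_lactE tens_ractE.
Qed.

End Tensor.

Definition fin_gen (R : pzRingType) (P : lmodType R) : Prop :=
  exists (n : nat) (e : 'I_n -> P), forall p : P,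
    exists c : 'I_n -> R, p = \sum_(i < n) c i *: e i.

Definition projective (R : pzRingType) (P : lmodType R) : Prop :=
  forall (M N : lmodType R) (g : {linear M -> N}) (h : {linear P -> N}),
    (forall y : N, exists x : M, g x = y) ->
  exists l : {linear P -> M}, forall p : P, g (l p) = h p.

Definition fg_projective (R : pzRingType) (P : lmodType R) : Prop :=
  fin_gen P /\ projective P.

Section LinHom.
Context (R : pzRingType) (M N : lmodType R).

Definition linear_pred : {pred M -> N} := fun h => `[< linear h >].

Fact linear_pred_zmod_closed : zmod_closed linear_pred.
Proof.
split=> [|g h]; rewrite !unfold_in.
  by apply/asboolP=> a x y; rewrite -[LHS]/(0 : N) -[RHS]/(a *: (0 : N) + 0) scaler0 addr0.
move=> /asboolP gL /asboolP hL; apply/asboolP=> a x y.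
rewrite -[LHS]/(g _ - h _) -[RHS]/(a *: (g x - h x) + (g y - h y)).
by rewrite gL hL scalerBr opprD addrACA.
Qed.
HB.instance Definition _ :=
  GRing.isZmodClosed.Build (M -> N) linear_pred linear_pred_zmod_closed.

Definition linHom : Type := {h : M -> N | h \in linear_pred}.
HB.instance Definition _ := SubChoice.on linHom.
HB.instance Definition _ := [SubChoice_isSubZmodule of linHom by <:].

End LinHom.

Arguments linear_pred {R} M N.

Definition centralizer (A : pzRingType) (X : set A) : set A :=
  [set a | forall x, X x -> a * x = x * a].

Section CentralizerRing.
Context (A : pzRingType) (X : set A).

Definition cent_pred : {pred A} := fun a => `[< centralizer X a >].

Lemma cent_predP a : reflect (centralizer X a) (a \in cent_pred).
Proof. exact: asboolP. Qed.

Fact cent_subring_closed : subring_closed cent_pred.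
Proof.
split=> [|a b|a b].
- by apply/cent_predP=> x _; rewrite mul1r mulr1.
- move=> /cent_predP aX /cent_predP bX; apply/cent_predP=> x Xx.
  by rewrite mulrBl mulrBr aX ?bX.
- move=> /cent_predP aX /cent_predP bX; apply/cent_predP=> x Xx.
  by rewrite -mulrA bX // mulrA aX // mulrA.
Qed.
HB.instance Definition _ :=
  GRing.isSubringClosed.Build A cent_pred cent_subring_closed.

Definition cent_ring : Type := {a : A | a \in cent_pred}.
HB.instance Definition _ := SubChoice.on cent_ring.
HB.instance Definition _ :=
  GRing.SubChoice_isSubPzRing.Build _ _ cent_ring cent_subring_closed.

Definition cent_val : {rmorphism cent_ring -> A} := val.

End CentralizerRing.

Section Extension.
(* The extension A | B is the morphism f. *)
Context (B A : pzRingType) (f : {rmorphism B -> A}).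

(* R = V_A(B) *)
Definition ext_cent : pzRingType := cent_ring (range f).

(* W = V_A(V_A(B)) *)
Definition double_cent : pzRingType := cent_ring (centralizer (range f)).

Fact double_cent_subproof (b : B) : f b \in cent_pred (centralizer (range f)).
Proof. by apply/cent_predP=> a; move/(_ (f b)) => -> //; exists b. Qed.

Definition double_cent_map (b : B) : double_cent :=
  exist _ (f b) (double_cent_subproof b).

Fact double_cent_map_zmod_morphism : zmod_morphism double_cent_map.
Proof. by move=> a b; apply: val_inj; rewrite /= rmorphB. Qed.
Fact double_cent_map_monoid_morphism : monoid_morphism double_cent_map.
Proof.
by split=> [|a b]; apply: val_inj; rewrite /= ?rmorph1 ?rmorphM.
Qed.
HB.instance Definition _ :=
  GRing.isZmodMorphism.Build B double_cent double_cent_map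
    double_cent_map_zmod_morphism.
HB.instance Definition _ :=
  GRing.isMonoidMorphism.Build B double_cent double_cent_map
    double_cent_map_monoid_morphism.

Definition ext_WB : {rmorphism B -> double_cent} := double_cent_map.
Definition ext_AW : {rmorphism double_cent -> A} := cent_val _.

Definition bimod_AB : bimod A B := res_bimod idfun f (reg_bimod A).
Definition bimod_BA : bimod B A := res_bimod f idfun (reg_bimod A).
Definition bimod_BB : bimod B B := res_bimod f f (reg_bimod A).
Definition bimod_RA : bimod ext_cent A :=
  res_bimod (cent_val _) idfun (reg_bimod A).
Definition bimod_AR : bimod A ext_cent :=
  res_bimod idfun (cent_val _) (reg_bimod A).

(* A (x)_B A *)
Definition AxA : bimod A A := tens_bimod bimod_AB bimod_BA.
Definition AxA_BA : bimod B A := res_bimod f idfun AxA.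
Definition AxA_AB : bimod A B := res_bimod idfun f AxA.

Definition left_D2 : Prop :=
  exists2 N : nat, (0 < N)%N & direct_summand AxA_BA (pow_bimod bimod_BA N).

Definition right_D2 : Prop :=
  exists2 N : nat, (0 < N)%N & direct_summand AxA_AB (pow_bimod bimod_AB N).

Definition mult_map : AxA -> reg_bimod A :=
  @tens_lift _ _ _ bimod_AB bimod_BA A (fun x y : A => x * y).

Lemma mult_mapE (x y : A) :
  mult_map (@tens_mk _ _ _ bimod_AB bimod_BA x y) = x * y.
Proof.
apply: tens_liftE; split=> /= *; first exact: mulrDl.
  exact: mulrDr.
exact: esym (mulrA _ _ _).
Qed.

Definition separable_ext : Prop := split_epi mult_map.

(* S = End(_B A_B) *)
Definition endo_pred : {pred A -> A} :=
  fun h => `[< @bimod_hom _ _ bimod_BB bimod_BB h >].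

Lemma endo_predP h :
  reflect (@bimod_hom _ _ bimod_BB bimod_BB h) (h \in endo_pred).
Proof. exact: asboolP. Qed.

Fact endo_zmod_closed : zmod_closed endo_pred.
Proof.
split=> [|g h].
  by apply/endo_predP; split=> *; rewrite /= ?fctE ?addr0 ?mulr0 ?mul0r.
move=> /endo_predP[gD gl gr] /endo_predP[hD hl hr].
have E x : (g - h) x = g x - h x by [].
apply/endo_predP; split=> [x y|r x|x s]; rewrite !E.
- by rewrite gD hD opprD addrACA.
- by rewrite gl hl /= mulrBr.
- by rewrite gr hr /= mulrBl.
Qed.
HB.instance Definition _ :=
  GRing.isZmodClosed.Build (A -> A) endo_pred endo_zmod_closed.

Definition endo : Type := {h : A -> A | h \in endo_pred}.
HB.instance Definition _ := SubChoice.on endo.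
HB.instance Definition _ := [SubChoice_isSubZmodule of endo by <:].

Lemma ext_centC (r : ext_cent) (b : B) : val r * f b = f b * val r.
Proof. by case: r => r /= /cent_predP; apply; exists b. Qed.

Fact endo_lact_subproof (r : ext_cent) (h : endo) :
  (fun x => val r * val h x) \in endo_pred.
Proof.
case: h => h /= /endo_predP[hD hl hr]; apply/endo_predP.
split=> [x y|b x|x b] /=.
- by rewrite hD mulrDr.
- by rewrite hl /= !mulrA ext_centC.
- by rewrite hr /= mulrA.
Qed.

Fact endo_ract_subproof (h : endo) (r : ext_cent) :
  (fun x => val h x * val r) \in endo_pred.
Proof.
case: h => h /= /endo_predP[hD hl hr]; apply/endo_predP.
split=> [x y|b x|x b] /=.
- by rewrite hD mulrDl.
- by rewrite hl /= mulrA.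
- by rewrite hr /= -!mulrA ext_centC.
Qed.

Definition endo_lact (r : ext_cent) (h : endo) : endo :=
  exist _ (fun x => val r * val h x) (endo_lact_subproof r h).
Definition endo_ract (h : endo) (r : ext_cent) : endo :=
  exist _ (fun x => val h x * val r) (endo_ract_subproof h r).

Program Definition endo_bimod : bimod ext_cent ext_cent :=
  @Bimod ext_cent ext_cent endo endo_lact endo_ract _ _ _ _ _ _ _ _ _.
Next Obligation. by move=> *; apply/val_inj/funext=> x; rewrite /= mulrA. Qed.
Next Obligation. by move=> *; apply/val_inj/funext=> x; rewrite /= mul1r. Qed.
Next Obligation. by move=> *; apply/val_inj/funext=> x; exact: mulrDr. Qed.
Next Obligation. by move=> *; apply/val_inj/funext=> x; exact: mulrDl. Qed.
Next Obligation. by move=> *; apply/val_inj/funext=> x; rewrite /= mulrA. Qed.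
Next Obligation. by move=> *; apply/val_inj/funext=> x; rewrite /= mulr1. Qed.
Next Obligation. by move=> *; apply/val_inj/funext=> x; exact: mulrDl. Qed.
Next Obligation. by move=> *; apply/val_inj/funext=> x; exact: mulrDr. Qed.
Next Obligation. by move=> *; apply/val_inj/funext=> x; rewrite /= mulrA. Qed.

(* Hom(_R S, _R A) with (b . G . a)(alpha) = b G(alpha) a *)
Definition homL : zmodType :=
  linHom (left_mod endo_bimod) (left_mod bimod_RA).

Definition homL_fun (G : homL) : endo -> A := val G.

Lemma homLP (G : homL) : linear (val G).
Proof. by case: G => G /= /asboolP. Qed.

Fact homL_lact_subproof (b : B) (G : homL) :
  ((fun h => f b * homL_fun G h) : left_mod endo_bimod -> left_mod bimod_RA)
    \in linear_pred (left_mod endo_bimod) (left_mod bimod_RA).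
Proof.
apply/asboolP=> r g h; rewrite /homL_fun homLP mulrDr; congr (_ + _).
by rewrite -[RHS]/(val r * (f b * _)) !mulrA ext_centC.
Qed.

Fact homL_ract_subproof (G : homL) (a : A) :
  ((fun h => homL_fun G h * a) : left_mod endo_bimod -> left_mod bimod_RA)
    \in linear_pred (left_mod endo_bimod) (left_mod bimod_RA).
Proof.
apply/asboolP=> r g h; rewrite /homL_fun homLP mulrDl; congr (_ + _).
exact: esym (mulrA _ _ _).
Qed.

Program Definition homL_bimod : bimod B A :=
  @Bimod B A homL (fun b G => exist _ _ (homL_lact_subproof b G))
    (fun G a => exist _ _ (homL_ract_subproof G a)) _ _ _ _ _ _ _ _ _.
Next Obligation. by move=> *; apply/val_inj/funext=> h; rewrite /= rmorphM /homL_fun/= mulrA. Qed.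
Next Obligation. by move=> *; apply/val_inj/funext=> h; rewrite /= rmorph1 mul1r. Qed.
Next Obligation. by move=> *; apply/val_inj/funext=> h; exact: mulrDr. Qed.
Next Obligation. by move=> *; apply/val_inj/funext=> h; rewrite /= rmorphD; exact: mulrDl. Qed.
Next Obligation. by move=> *; apply/val_inj/funext=> h; rewrite /= /homL_fun/= mulrA. Qed.
Next Obligation. by move=> *; apply/val_inj/funext=> h; rewrite /= mulr1. Qed.
Next Obligation. by move=> *; apply/val_inj/funext=> h; exact: mulrDl. Qed.
Next Obligation. by move=> *; apply/val_inj/funext=> h; exact: mulrDr. Qed.
Next Obligation. by move=> *; apply/val_inj/funext=> h; rewrite /= /homL_fun/= mulrA. Qed.

(* Psi(x (x) y)(alpha) = alpha(x) y *)
Fact PsiL_subproof (x y : A) :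
  ((fun h => val (h : endo) x * y) : left_mod endo_bimod -> left_mod bimod_RA)
    \in linear_pred (left_mod endo_bimod) (left_mod bimod_RA).
Proof.
apply/asboolP=> r g h; rewrite mulrDl; congr (_ + _).
exact: esym (mulrA _ _ _).
Qed.

Definition PsiL_pure (x y : A) : homL :=
  exist (fun h => h \in linear_pred _ _) _ (PsiL_subproof x y).

Definition PsiL : AxA_BA -> homL_bimod :=
  @tens_lift _ _ _ bimod_AB bimod_BA homL
    PsiL_pure.

Fact balanced_PsiL : @balanced _ _ _ bimod_AB bimod_BA homL PsiL_pure.
Proof.
split=> /= x y z; apply/val_inj/funext=> -[h H] /=;
  have /endo_predP[hD hl hr] := H.
- by rewrite hD; exact: mulrDl.
- exact: mulrDr.
- by rewrite hr /= -mulrA.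
Qed.

Lemma PsiLE (x y : A) (h : endo) :
  homL_fun (PsiL (@tens_mk _ _ _ bimod_AB bimod_BA x y)) h = val h x * y.
Proof. by rewrite /PsiL tens_liftE //; exact: balanced_PsiL. Qed.

Lemma PsiL_hom : bimod_hom PsiL.
Proof.
have D z w : PsiL (z + w) = PsiL z + PsiL w :=
  tens_liftD balanced_PsiL z w.
have E x y : PsiL (tens_mk x y) = PsiL_pure x y :=
  tens_liftE balanced_PsiL x y.
split=> // [b|z a].
  apply: tens_ext => [z w|z w|x y]; rewrite ?lactDr ?D ?lactDr //.
  rewrite [lact _ _]tens_lactE !E; apply/val_inj/funext=> -[h H] /=.
  by have /endo_predP[_ -> _] := H; rewrite /homL_fun /= mulrA.
move: z; apply: tens_ext => [z w|z w|x y]; rewrite ?ractDl ?D ?ractDl //.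
rewrite [ract _ _]tens_ractE !E; apply/val_inj/funext=> -[h H] /=.
by rewrite /homL_fun /= mulrA.
Qed.

Definition weak_left_D2 : Prop :=
  fg_projective (left_mod endo_bimod) /\ split_epi PsiL.

(* Hom(S_R, A_R) with (a . G . b)(alpha) = a G(alpha) b *)
Definition homR : zmodType :=
  linHom (right_mod endo_bimod) (right_mod bimod_AR).

Definition homR_fun (G : homR) : endo -> A := val G.

Lemma homRP (G : homR) : linear (val G).
Proof. by case: G => G /= /asboolP. Qed.

Fact homR_lact_subproof (a : A) (G : homR) :
  ((fun h => a * homR_fun G h) : right_mod endo_bimod -> right_mod bimod_AR)
    \in linear_pred (right_mod endo_bimod) (right_mod bimod_AR).
Proof.
apply/asboolP=> r g h; rewrite /homR_fun homRP mulrDr; congr (_ + _).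
exact: mulrA.
Qed.

Fact homR_ract_subproof (G : homR) (b : B) :
  ((fun h => homR_fun G h * f b) : right_mod endo_bimod -> right_mod bimod_AR)
    \in linear_pred (right_mod endo_bimod) (right_mod bimod_AR).
Proof.
apply/asboolP=> r g h; rewrite /homR_fun homRP mulrDl; congr (_ + _).
by rewrite -[RHS]/(_ * f b * val (r : ext_cent)) -mulrA -ext_centC mulrA.
Qed.

Program Definition homR_bimod : bimod A B :=
  @Bimod A B homR (fun a G => exist _ _ (homR_lact_subproof a G))
    (fun G b => exist _ _ (homR_ract_subproof G b)) _ _ _ _ _ _ _ _ _.
Next Obligation. by move=> *; apply/val_inj/funext=> h; rewrite /= /homR_fun/= mulrA. Qed.
Next Obligation. by move=> *; apply/val_inj/funext=> h; rewrite /= mul1r. Qed.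
Next Obligation. by move=> *; apply/val_inj/funext=> h; exact: mulrDr. Qed.
Next Obligation. by move=> *; apply/val_inj/funext=> h; exact: mulrDl. Qed.
Next Obligation. by move=> *; apply/val_inj/funext=> h; rewrite /= rmorphM /homR_fun/= mulrA. Qed.
Next Obligation. by move=> *; apply/val_inj/funext=> h; rewrite /= rmorph1 mulr1. Qed.
Next Obligation. by move=> *; apply/val_inj/funext=> h; exact: mulrDl. Qed.
Next Obligation. by move=> *; apply/val_inj/funext=> h; rewrite /= rmorphD; exact: mulrDr. Qed.
Next Obligation. by move=> *; apply/val_inj/funext=> h; rewrite /= /homR_fun/= mulrA. Qed.

(* x (x) y |-> (alpha |-> x alpha(y)) *)
Fact PsiR_subproof (x y : A) :
  ((fun h => x * val (h : endo) y) : right_mod endo_bimod -> right_mod bimod_AR)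
    \in linear_pred (right_mod endo_bimod) (right_mod bimod_AR).
Proof.
apply/asboolP=> r g h; rewrite mulrDr; congr (_ + _).
exact: mulrA.
Qed.

Definition PsiR_pure (x y : A) : homR :=
  exist (fun h => h \in linear_pred _ _) _ (PsiR_subproof x y).

Definition PsiR : AxA_AB -> homR_bimod :=
  @tens_lift _ _ _ bimod_AB bimod_BA homR
    PsiR_pure.

Fact balanced_PsiR : @balanced _ _ _ bimod_AB bimod_BA homR PsiR_pure.
Proof.
split=> /= x y z; apply/val_inj/funext=> -[h H] /=;
  have /endo_predP[hD hl hr] := H.
- exact: mulrDl.
- by rewrite hD; exact: mulrDr.
- by rewrite hl /= mulrA.
Qed.

Lemma PsiRE (x y : A) (h : endo) :
  homR_fun (PsiR (@tens_mk _ _ _ bimod_AB bimod_BA x y)) h = x * val h y.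
Proof. by rewrite /PsiR tens_liftE //; exact: balanced_PsiR. Qed.

Lemma PsiR_hom : bimod_hom PsiR.
Proof.
have D z w : PsiR (z + w) = PsiR z + PsiR w :=
  tens_liftD balanced_PsiR z w.
have E x y : PsiR (tens_mk x y) = PsiR_pure x y :=
  tens_liftE balanced_PsiR x y.
split=> // [a|z b].
  apply: tens_ext => [z w|z w|x y]; rewrite ?lactDr ?D ?lactDr //.
  rewrite [lact _ _]tens_lactE !E; apply/val_inj/funext=> -[h H] /=.
  by rewrite /homR_fun /= mulrA.
move: z; apply: tens_ext => [z w|z w|x y]; rewrite ?ractDl ?D ?ractDl //.
rewrite [ract _ _]tens_ractE !E; apply/val_inj/funext=> -[h H] /=.
by have /endo_predP[_ _ ->] := H; rewrite /homR_fun /= mulrA.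
Qed.

Definition weak_right_D2 : Prop :=
  fg_projective (right_mod endo_bimod) /\ split_epi PsiR.

End Extension.

(* Main.v *)
Require Import Defs.
From HB Require Import structures.
From mathcomp Require Import all_boot all_algebra.
From mathcomp Require Import boolp classical_sets functions.

Set Implicit Arguments.
Unset Strict Implicit.
Unset Printing Implicit Defensive.

Import GRing.Theory.

Local Open Scope ring_scope.

(** Let R = V_A(B) and W = V_A(V_A(B)). Everything in R commutes with W, so R is
also the centralizer of W, and the D2 data of A | B, whose scalars lie in R,
can be transported to A | W.

A left D2 structure on A | B amounts to a quasi-basis: B-central elements t_i of
A (x)_B A and B-bimodule endomorphisms beta_i of A with
x (x) y = sum_i t_i (beta_i x) y ([left_D2_quasi_basis]). Applying
x (x) y |-> alpha(x) y to this identity at y = 1 expands every alpha in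
End(_B A_B) as sum_i Psi(t_i)(alpha) beta_i, and Psi(t_i)(alpha) lies in R because
t_i is B-central. So the beta_i with the functionals Psi(t_i) form a dual basis.
Conversely, any such expansion with central t_i makes the extension weak left D2,
the splitting of Psi being G |-> sum_i t_i G(beta_i)
([weak_left_D2_of_quasi_basis]).

It remains to find such an expansion for A | W. If sum_k u_k (x) v_k is a
separability element of W | B, then
- beta |-> (x |-> sum_(k, l) u_k beta(v_k x u_l) v_l) turns B-bimodule
  endomorphisms of A into W-bimodule ones, fixing the latter;
- t |-> sum_k u_k t v_k sends B-central elements of A (x)_B A to W-central
  elements of A (x)_W A.
For alpha in End(_W A_W) the scalar r_i = Psi(t_i)(alpha) commutes with W. Hence
averaging alpha = sum_i r_i beta_i only replaces beta_i by its average, and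
replacing t_i by its average changes r_i into sum_k u_k r_i v_k = r_i
([average_expansionl], [PsiL_tens_average]). The averaged data is therefore the
required expansion ([weak_left_D2_of_separable]). The argument uses W only
through V_A(B) being contained in V_A(W), so it is carried out for any
factorization B -> W -> A with this property. The right-handed case is the mirror
image. *)

(** * Modules, bimodules and tensor products *)

Section ModuleLemmas.

(** The easy half of the dual basis lemma: to lift h through g, lift each h (e i)
and recombine with the coordinate functionals. *)
Lemma fg_projective_dual_basis (R : pzRingType) (P : lmodType R) (n : nat)
    (e : 'I_n -> P) (c : 'I_n -> P -> R) :
    (forall i (r : R) (p q : P), c i (r *: p + q) = r * c i p + c i q) ->
    (forall p, p = \sum_i c i p *: e i) ->
  fg_projective P.
Proof.
move=> cL cE; split; first by exists n, e => p; exists (c^~ p).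
move=> M N g h g_surj.
have /fin_all_exists[m mE] i : exists x, g x = h (e i) by apply: g_surj.
pose l p := \sum_i c i p *: m i.
have lL : linear l.
  move=> r p q; rewrite /l scaler_sumr -big_split; apply: eq_bigr => i _.
  by rewrite cL scalerDl scalerA.
pose l_lin : {linear P -> M} :=
  HB.pack l (GRing.isLinear.Build _ _ _ _ l lL).
exists l_lin => p; rewrite [in RHS](cE p) !linear_sum; apply: eq_bigr => i _.
by rewrite !linearZ mE.
Qed.

Lemma bimod_hom0 (R S : pzRingType) (M N : bimod R S) (h : M -> N) :
  bimod_hom h -> h 0 = 0.
Proof. by case=> hD _ _; apply: (addrI (h 0)); rewrite -hD !addr0. Qed.

Lemma bimod_hom_sum (R S : pzRingType) (M N : bimod R S) (h : M -> N)
    (I : Type) (s : seq I) (F : I -> M) :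
  bimod_hom h -> h (\sum_(i <- s) F i) = \sum_(i <- s) h (F i).
Proof.
by move=> hH; have [hD _ _] := hH; apply: (big_morph h hD (bimod_hom0 hH)).
Qed.

Lemma lact_sum (R S : pzRingType) (M : bimod R S) (r : R)
    (I : Type) (s : seq I) (F : I -> M) :
  lact r (\sum_(i <- s) F i) = \sum_(i <- s) lact r (F i).
Proof.
apply: (big_morph (lact r) (lactDr r)).
by apply: (addrI (lact r (0 : M))); rewrite -lactDr !addr0.
Qed.

Lemma ract_sum (R S : pzRingType) (M : bimod R S) (a : S)
    (I : Type) (s : seq I) (F : I -> M) :
  ract (\sum_(i <- s) F i) a = \sum_(i <- s) ract (F i) a.
Proof.
apply: (big_morph (fun m : M => ract m a) (fun x y => ractDl x y a)).
by apply: (addrI (ract (0 : M) a)); rewrite -ractDl !addr0.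
Qed.

(** Integer coefficients are absorbed in the first factor, so the sum needs none. *)
Lemma tens_sum_mk (R T S : pzRingType) (M : bimod R T) (N : bimod T S)
    (z : tens M N) :
  exists s : seq (M * N), z = \sum_(p <- s) tens_mk p.1 p.2.
Proof.
elim/tens_ind: z => [|_ _ [s ->] [t ->]|m n]; first by exists [::]; rewrite big_nil.
  exists (s ++ [seq (- p.1, p.2) | p <- t]).
  rewrite big_cat big_map; congr (_ + _); rewrite -sumrN; apply: eq_bigr => p _.
  apply: (addrI (tens_mk p.1 p.2)); rewrite subrr -tens_mkDl subrr.
  by apply: (addrI (tens_mk 0 p.2)); rewrite -tens_mkDl !addr0.
by exists [:: (m, n)]; rewrite big_seq1.
Qed.

Lemma tens_lift_sum (R T S : pzRingType) (M : bimod R T) (N : bimod T S)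
    (P : zmodType) (h : M -> N -> P) (I : Type) (s : seq I) (F : I -> tens M N) :
    balanced h ->
  tens_lift h (\sum_(i <- s) F i) = \sum_(i <- s) tens_lift h (F i).
Proof.
by move=> hb; apply: (big_morph (tens_lift h) (tens_liftD hb) (tens_lift0 hb)).
Qed.

(** Lets the additive structure of the bimodule M ^ n be seen as that of
finite functions, so that coordinates can be taken. *)
Definition pow_coef (R S : pzRingType) (M : bimod R S) n
    (v : pow_bimod M n) : {ffun 'I_n -> M} := v.

Lemma pow_coef_sum (R S : pzRingType) (M : bimod R S) n (I : Type) (s : seq I)
    (F : I -> pow_bimod M n) i :
  pow_coef (\sum_(k <- s) F k) i = \sum_(k <- s) pow_coef (F k) i.
Proof. exact: sum_ffunE. Qed.

Lemma direct_summand_retract (R S : pzRingType) (X Y : bimod R S) :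
    direct_summand X Y ->
  exists (p : X -> Y) (q : Y -> X), [/\ bimod_hom p, bimod_hom q & cancel p q].
Proof.
case=> C [h [hD hl hr] [k hk kh]].
exists (fun x => h (x, 0)), (fun y => (k y).1); split.
- split=> [x y|r x|x s].
  + by rewrite -hD; congr h; congr pair; rewrite /= addr0.
  + rewrite -hl; congr h; congr pair => /=.
    by apply: (addrI (lact r (0 : C))); rewrite -lactDr !addr0.
  + rewrite -hr; congr h; congr pair => /=.
    by apply: (addrI (ract (0 : C) s)); rewrite -ractDl !addr0.
- split=> [x y|r x|x s].
  + by rewrite -[in LHS](kh x) -[in LHS](kh y) -hD hk.
  + by rewrite -[in LHS](kh x) -hl hk.
  + by rewrite -[in LHS](kh x) -hr hk.
- by move=> x; rewrite hk.
Qed.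

End ModuleLemmas.

(** * Quasi-bases of depth two extensions *)

Local Open Scope classical_set_scope.

Section QuasiBases.
Context (B A : pzRingType) (f : {rmorphism B -> A}).

(** Pure tensors, stated over A itself: the factors of the tensor product have
types that hide the multiplication of A. *)
Definition mk (x y : A) : AxA f := @tens_mk _ _ _ (bimod_AB f) (bimod_BA f) x y.

Lemma mkDl x x' y : mk (x + x') y = mk x y + mk x' y.
Proof. exact: tens_mkDl. Qed.

Lemma mkDr x y y' : mk x (y + y') = mk x y + mk x y'.
Proof. exact: tens_mkDr. Qed.

Lemma mkA x b y : mk (x * f b) y = mk x (f b * y).
Proof. exact: tens_mkA. Qed.

Lemma lact_mk a x y : lact a (mk x y) = mk (a * x) y.
Proof. exact: tens_lactE. Qed.

Lemma ract_mk x y a : ract (mk x y) a = mk x (y * a).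
Proof. exact: tens_ractE. Qed.

Lemma AxA_ext (P : zmodType) (h h' : AxA f -> P) :
    {morph h : z z' / z + z'} -> {morph h' : z z' / z + z'} ->
    (forall x y, h (mk x y) = h' (mk x y)) ->
  h =1 h'.
Proof. exact: tens_ext. Qed.

Definition base_central (t : AxA f) : Prop :=
  forall b, lact (f b) t = ract t (f b).

(** Let p and q be the bimodule maps of A (x)_B A into A^n and back. Then beta_i is
the i-th coordinate of p(x (x) 1) and t_i is the image under q of the i-th unit
vector, which is B-central because that vector is. *)
Lemma left_D2_quasi_basis :
    left_D2 f ->
  exists (n : nat) (t : 'I_n -> AxA f) (beta : 'I_n -> endo f),
    (forall i, base_central (t i)) /\
    (forall x y, mk x y = \sum_i ract (t i) (val (beta i) x * y)).
Proof.
case=> n _ /direct_summand_retract[p [q [pH qH pK]]].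
have [[pD pl pr] [qD ql qr]] := (pH, qH).
have {}pl b (z : AxA f) : p (lact (f b) z) = lact b (p z) := pl b z.
have {}pr (z : AxA f) a : p (ract z a) = ract (p z) a := pr z a.
have {}ql b v : q (lact b v) = lact (f b) (q v : AxA f) := ql b v.
have {}qr v a : q (ract v a) = ract (q v : AxA f) a := qr v a.
pose d i : pow_bimod (bimod_BA f) n := [ffun j => ((i == j)%:R : A)].
(* Right B-linearity: p (xb (x) 1) = p (x (x) b) = p (x (x) 1) b. *)
have betaP i : (fun x => pow_coef (p (mk x 1)) i) \in endo_pred f.
  apply/endo_predP; split=> [x y|b x|x b].
  - by rewrite mkDl pD ffunE.
  - by rewrite -lact_mk pl ffunE.
  - by rewrite /= mkA mulr1 -[f b in LHS]mul1r -ract_mk pr ffunE.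
exists n, (fun i => q (d i)),
  (fun i => exist (fun h => h \in endo_pred f) _ (betaP i)).
split=> [i b|x y].
  rewrite -ql -qr; congr q; apply/ffunP => j; rewrite !ffunE /=.
  by case: eqP; rewrite /= ?(mulr1, mul1r, mulr0, mul0r).
rewrite -[LHS]pK.
have -> : p (mk x y) = \sum_i ract (d i) (pow_coef (p (mk x 1)) i * y).
  rewrite -[y in LHS]mul1r -ract_mk.
  apply/ffunP=> j; rewrite pr; apply: etrans (esym (pow_coef_sum _ _ _)).
  rewrite ffunE (bigD1 j) //= !ffunE eqxx.
  by rewrite mul1r big1 ?addr0 // => i /negPf ij; rewrite !ffunE ij mul0r.
by rewrite (bimod_hom_sum _ _ qH); apply: eq_bigr => i _; rewrite qr.
Qed.

(** Mirror image: beta_i is the i-th coordinate of p(1 (x) x). *)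
Lemma right_D2_quasi_basis :
    right_D2 f ->
  exists (n : nat) (t : 'I_n -> AxA f) (beta : 'I_n -> endo f),
    (forall i, base_central (t i)) /\
    (forall x y, mk x y = \sum_i lact (x * val (beta i) y) (t i)).
Proof.
case=> n _ /direct_summand_retract[p [q [pH qH pK]]].
have [[pD pl pr] [qD ql qr]] := (pH, qH).
have {}pl a (z : AxA f) : p (lact a z) = lact a (p z) := pl a z.
have {}pr (z : AxA f) b : p (ract z (f b)) = ract (p z) b := pr z b.
have {}ql a v : q (lact a v) = lact a (q v : AxA f) := ql a v.
have {}qr v b : q (ract v b) = ract (q v : AxA f) (f b) := qr v b.
pose d i : pow_bimod (bimod_AB f) n := [ffun j => ((i == j)%:R : A)].
(* Left B-linearity: p (1 (x) bx) = p (b (x) x) = b p (1 (x) x). *)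
have betaP i : (fun y => pow_coef (p (mk 1 y)) i) \in endo_pred f.
  apply/endo_predP; split=> [x y|b x|x b].
  - by rewrite mkDr pD ffunE.
  - by rewrite /= -mkA mul1r -[f b in LHS]mulr1 -lact_mk pl ffunE.
  - by rewrite -ract_mk pr ffunE.
exists n, (fun i => q (d i)),
  (fun i => exist (fun h => h \in endo_pred f) _ (betaP i)).
split=> [i b|x y].
  rewrite -ql -qr; congr q; apply/ffunP => j; rewrite !ffunE /=.
  by case: eqP; rewrite /= ?(mulr1, mul1r, mulr0, mul0r).
rewrite -[LHS]pK.
have -> : p (mk x y) = \sum_i lact (x * pow_coef (p (mk 1 y)) i) (d i).
  rewrite -[x in LHS]mulr1 -lact_mk.
  apply/ffunP=> j; rewrite pl; apply: etrans (esym (pow_coef_sum _ _ _)).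
  rewrite ffunE (bigD1 j) //= !ffunE eqxx.
  by rewrite mulr1 big1 ?addr0 // => i /negPf ij; rewrite !ffunE ij mulr0.
by rewrite (bimod_hom_sum _ _ qH); apply: eq_bigr => i _; rewrite ql.
Qed.

Lemma homL_funD (G G' : homL f) h :
  homL_fun (G + G') h = homL_fun G h + homL_fun G' h.
Proof. by []. Qed.

Lemma homR_funD (G G' : homR f) h :
  homR_fun (G + G') h = homR_fun G h + homR_fun G' h.
Proof. by []. Qed.

Lemma PsiL_lact b (z : AxA f) h :
  homL_fun (PsiL (lact (f b) z)) h = f b * homL_fun (PsiL z) h.
Proof.
have [_ Pl _] := PsiL_hom f.
by have -> : PsiL (lact (f b) z) = lact b (PsiL z) := Pl b z.
Qed.

Lemma PsiL_ract (z : AxA f) a h :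
  homL_fun (PsiL (ract z a)) h = homL_fun (PsiL z) h * a.
Proof.
have [_ _ Pr] := PsiL_hom f.
by have -> : PsiL (ract z a) = ract (PsiL z) a := Pr z a.
Qed.

Lemma PsiR_lact a (z : AxA f) h :
  homR_fun (PsiR (lact a z)) h = a * homR_fun (PsiR z) h.
Proof.
have [_ Pl _] := PsiR_hom f.
by have -> : PsiR (lact a z) = lact a (PsiR z) := Pl a z.
Qed.

Lemma PsiR_ract (z : AxA f) b h :
  homR_fun (PsiR (ract z (f b))) h = homR_fun (PsiR z) h * f b.
Proof.
have [_ _ Pr] := PsiR_hom f.
by have -> : PsiR (ract z (f b)) = ract (PsiR z) b := Pr z b.
Qed.

Lemma PsiL_sum (I : Type) (s : seq I) (F : I -> AxA f) h :
  homL_fun (PsiL (\sum_(i <- s) F i)) h = \sum_(i <- s) homL_fun (PsiL (F i)) h.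
Proof.
by rewrite (bimod_hom_sum _ _ (PsiL_hom f)) /homL_fun raddf_sum fct_sumE.
Qed.

Lemma PsiR_sum (I : Type) (s : seq I) (F : I -> AxA f) h :
  homR_fun (PsiR (\sum_(i <- s) F i)) h = \sum_(i <- s) homR_fun (PsiR (F i)) h.
Proof.
by rewrite (bimod_hom_sum _ _ (PsiR_hom f)) /homR_fun raddf_sum fct_sumE.
Qed.

(** Psi is a bimodule map, so it carries the centrality of t over to its values;
these can then serve as scalars in R. *)
Lemma PsiL_cent t h :
  base_central t -> homL_fun (PsiL t) h \in cent_pred (range f).
Proof.
by move=> tC; apply/cent_predP=> _ [b _ <-]; rewrite -PsiL_ract -PsiL_lact tC.
Qed.

Lemma PsiR_cent t h :
  base_central t -> homR_fun (PsiR t) h \in cent_pred (range f).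
Proof.
by move=> tC; apply/cent_predP=> _ [b _ <-]; rewrite -PsiR_ract -PsiR_lact tC.
Qed.

(** The hypothesis says that the beta_i generate S = End(_B A_B) over R, with
coordinate functionals c_i = Psi(t_i). This is a dual basis, and as every left
R-linear G is determined by its values G(beta_i), the map
G |-> sum_i t_i G(beta_i) splits Psi. It is left B-linear since the t_i are
central. *)
Lemma weak_left_D2_of_quasi_basis (n : nat) (t : 'I_n -> AxA f)
    (beta : 'I_n -> endo f) :
    (forall i, base_central (t i)) ->
    (forall (h : endo f) x,
      val h x = \sum_i homL_fun (PsiL (t i)) h * val (beta i) x) ->
  weak_left_D2 f.
Proof.
move=> tC tE; have [_ _ Pr] := PsiL_hom f.
have PC i h := PsiL_cent h (tC i).
pose c i h : ext_cent f :=
  exist (fun a => a \in cent_pred (range f)) _ (PC i h).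
have cL i (r : ext_cent f) (g h : left_mod (endo_bimod f)) :
    c i (r *: g + h) = r * c i g + c i h.
  by apply: val_inj; rewrite /= /homL_fun homLP.
have cE (h : left_mod (endo_bimod f)) :
    h = \sum_i c i h *: (beta i : left_mod (endo_bimod f)).
  apply/val_inj/funext=> x; rewrite tE raddf_sum fct_sumE.
  by apply: eq_bigr.
split; first exact: fg_projective_dual_basis cL cE.
split; first exact: PsiL_hom.
pose s (G : homL f) : AxA f := \sum_i ract (t i) (homL_fun G (beta i)).
have sD G G' : s (G + G') = s G + s G'.
  by rewrite /s -big_split; apply: eq_bigr => i _; rewrite homL_funD ractDr.
have sl b (G : homL_bimod f) : s (lact b G) = lact (f b) (s G).
  by rewrite /s lact_sum; apply: eq_bigr => i _; rewrite lractA tC ractA.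
have sr (G : homL_bimod f) a : s (ract G a) = ract (s G) a.
  by rewrite /s ract_sum; apply: eq_bigr => i _; rewrite ractA.
exists s; first by split.
move=> G; rewrite (bimod_hom_sum _ _ (PsiL_hom f)).
apply/val_inj/funext=> h; rewrite raddf_sum fct_sumE.
rewrite [in RHS](cE h).
pose G' : {linear left_mod (endo_bimod f) -> left_mod (bimod_RA f)} :=
  HB.pack (val G) (GRing.isLinear.Build _ _ _ _ (val G) (homLP G)).
rewrite -[RHS]/(G' _) linear_sum; apply: eq_bigr => i _; rewrite linearZ.
by have -> := Pr (t i) (homL_fun G (beta i)).
Qed.

(** Mirror image, with the splitting G |-> sum_i G(beta_i) t_i; scalars act from
the right, hence live in the converse ring of R. *)
Lemma weak_right_D2_of_quasi_basis (n : nat) (t : 'I_n -> AxA f)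
    (beta : 'I_n -> endo f) :
    (forall i, base_central (t i)) ->
    (forall (h : endo f) x,
      val h x = \sum_i val (beta i) x * homR_fun (PsiR (t i)) h) ->
  weak_right_D2 f.
Proof.
move=> tC tE; have [_ Pl _] := PsiR_hom f.
have PC i h := PsiR_cent h (tC i).
pose c i h : (ext_cent f)^c :=
  exist (fun a => a \in cent_pred (range f)) _ (PC i h).
have cL i (r : (ext_cent f)^c) (g h : right_mod (endo_bimod f)) :
    c i (r *: g + h) = r * c i g + c i h.
  by apply: val_inj; rewrite /= /homR_fun homRP.
have cE (h : right_mod (endo_bimod f)) :
    h = \sum_i c i h *: (beta i : right_mod (endo_bimod f)).
  apply/val_inj/funext=> x; rewrite tE raddf_sum fct_sumE.
  by apply: eq_bigr.
split; first exact: fg_projective_dual_basis cL cE.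
split; first exact: PsiR_hom.
pose s (G : homR f) : AxA f := \sum_i lact (homR_fun G (beta i)) (t i).
have sD G G' : s (G + G') = s G + s G'.
  by rewrite /s -big_split; apply: eq_bigr => i _; rewrite homR_funD lactDl.
have sl a (G : homR_bimod f) : s (lact a G) = lact a (s G).
  by rewrite /s lact_sum; apply: eq_bigr => i _; rewrite lactA.
have sr (G : homR_bimod f) b : s (ract G b) = ract (s G) (f b).
  by rewrite /s ract_sum; apply: eq_bigr => i _; rewrite -lractA -tC lactA.
exists s; first by split.
move=> G; rewrite (bimod_hom_sum _ _ (PsiR_hom f)).
apply/val_inj/funext=> h; rewrite raddf_sum fct_sumE.
rewrite [in RHS](cE h).
pose G' : {linear right_mod (endo_bimod f) -> right_mod (bimod_AR f)} :=
  HB.pack (val G) (GRing.isLinear.Build _ _ _ _ (val G) (homRP G)).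
rewrite -[RHS]/(G' _) linear_sum; apply: eq_bigr => i _; rewrite linearZ.
by have -> := Pl (homR_fun G (beta i)) (t i).
Qed.

End QuasiBases.

(** * Separability elements *)

Section SeparableBase.
Context (B W : pzRingType) (g : {rmorphism B -> W}).

(** Separability element of W | B, given by a list of pairs (u_k, v_k). The
equation w e = e w in W (x)_B W is expressed through all the balanced maps out of
W x W, the form in which averaging consumes it. *)
Definition casimir (e : seq (W * W)) : Prop :=
  \sum_(p <- e) p.1 * p.2 = 1 /\
  forall (P : zmodType) (phi : W -> W -> P),
    @balanced _ _ _ (bimod_AB g) (bimod_BA g) P phi ->
    forall w, \sum_(p <- e) phi (w * p.1) p.2 = \sum_(p <- e) phi p.1 (p.2 * w).

(** The element is the image of 1 under a splitting of the multiplication map. *)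
Lemma separable_casimir : separable_ext g -> exists e, casimir e.
Proof.
case=> mH [s [sD sl sr] sK].
have [e eE] := tens_sum_mk (s 1).
exists e; split=> [|P phi phib w].
  rewrite -[RHS]sK eE (bimod_hom_sum _ _ mH).
  by apply: eq_bigr => p _; rewrite mult_mapE.
pose L := @tens_lift _ _ _ (bimod_AB g) (bimod_BA g) P phi.
have LE x y : L (mk g x y) = phi x y := tens_liftE phib x y.
have : lact w (s 1) = ract (s 1) w by rewrite -sl -sr /= mulr1 mul1r.
rewrite eE lact_sum ract_sum => /(congr1 L).
rewrite /L !(tens_lift_sum _ _ phib) -/L.
under eq_bigr do rewrite [lact _ _]lact_mk LE.
by under [in RHS]eq_bigr do rewrite [ract _ _]ract_mk LE.
Qed.

End SeparableBase.

(** * Averaging along a separable extension *)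

Section Tower.
Context (B W A : pzRingType) (g : {rmorphism B -> W}) (j : {rmorphism W -> A}).
Context (f : {rmorphism B -> A}) (fE : forall b, f b = j (g b)).
Context (e : seq (W * W)) (eP : casimir g e).

Definition left_average (h : A -> A) (x : A) : A :=
  \sum_(p <- e) j p.1 * h (j p.2 * x).

Definition right_average (h : A -> A) (x : A) : A :=
  \sum_(p <- e) h (x * j p.1) * j p.2.

Lemma casimir_mul : \sum_(p <- e) j p.1 * j p.2 = 1.
Proof.
have [e1 _] := eP; rewrite -(rmorph1 j) -e1 rmorph_sum.
by apply: eq_bigr => p _; rewrite rmorphM.
Qed.

(** Apply the Casimir identity to the balanced map (u, v) |-> u h(v x). *)
Lemma left_average_linear (h : A -> A) :
    {morph h : x y / x + y} -> (forall b x, h (f b * x) = f b * h x) ->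
  forall w x, left_average h (j w * x) = j w * left_average h x.
Proof.
move=> hD hl w x; have [_ eC] := eP.
have /eC/(_ w) : @balanced _ _ _ (bimod_AB g) (bimod_BA g) A
    (fun u v => j u * h (j v * x)).
  split=> /= *; first by rewrite rmorphD mulrDl.
    by rewrite rmorphD mulrDl hD mulrDr.
  by rewrite !rmorphM -fE -mulrA -[in RHS]mulrA hl.
rewrite /left_average mulr_sumr => E; apply/esym.
under eq_bigr do rewrite mulrA -rmorphM.
by rewrite E; apply: eq_bigr => p _; rewrite rmorphM mulrA.
Qed.

(** Apply the Casimir identity to the balanced map (u, v) |-> h(x u) v. *)
Lemma right_average_linear (h : A -> A) :
    {morph h : x y / x + y} -> (forall b x, h (x * f b) = h x * f b) ->
  forall w x, right_average h (x * j w) = right_average h x * j w.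
Proof.
move=> hD hr w x; have [_ eC] := eP.
have /eC/(_ w) : @balanced _ _ _ (bimod_AB g) (bimod_BA g) A
    (fun u v => h (x * j u) * j v).
  split=> /= *; first by rewrite rmorphD mulrDr hD mulrDl.
    by rewrite rmorphD mulrDr.
  by rewrite !rmorphM -fE mulrA hr -mulrA.
rewrite /right_average mulr_suml => E.
under [in RHS]eq_bigr do rewrite -mulrA -rmorphM.
by rewrite -E; apply: eq_bigr => p _; rewrite rmorphM mulrA.
Qed.

Lemma left_averageD (h : A -> A) :
  {morph h : x y / x + y} -> {morph left_average h : x y / x + y}.
Proof.
move=> hD x y; rewrite /left_average -big_split; apply: eq_bigr => p _.
by rewrite mulrDr hD mulrDr.
Qed.

Lemma right_averageD (h : A -> A) :
  {morph h : x y / x + y} -> {morph right_average h : x y / x + y}.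
Proof.
move=> hD x y; rewrite /right_average -big_split; apply: eq_bigr => p _.
by rewrite mulrDl hD mulrDl.
Qed.

(** Averaging on one side acts through the argument and the value on that side
only, so it does not disturb linearity on the other side. *)
Lemma left_average_linr (h : A -> A) (a : A) :
  (forall x, h (x * a) = h x * a) ->
  forall x, left_average h (x * a) = left_average h x * a.
Proof.
move=> hr x; rewrite /left_average mulr_suml; apply: eq_bigr => p _.
by rewrite mulrA hr mulrA.
Qed.

Lemma right_average_linl (h : A -> A) (a : A) :
  (forall x, h (a * x) = a * h x) ->
  forall x, right_average h (a * x) = a * right_average h x.
Proof.
move=> hl x; rewrite /right_average mulr_sumr; apply: eq_bigr => p _.
by rewrite -mulrA hl mulrA.
Qed.

Lemma left_average_id (h : A -> A) :
  (forall w x, h (j w * x) = j w * h x) -> left_average h = h.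
Proof.
move=> hl; apply/funext=> x; rewrite /left_average.
under eq_bigr do rewrite hl mulrA.
by rewrite -mulr_suml casimir_mul mul1r.
Qed.

Lemma right_average_id (h : A -> A) :
  (forall w x, h (x * j w) = h x * j w) -> right_average h = h.
Proof.
move=> hr; apply/funext=> x; rewrite /right_average.
under eq_bigr do rewrite hr -mulrA.
by rewrite -mulr_sumr casimir_mul mulr1.
Qed.

Lemma average_endo (h : endo f) :
  right_average (left_average (val h)) \in endo_pred j.
Proof.
case: h => h /= /endo_predP[hD hl hr].
apply/endo_predP; split=> [x y|w x|x w] /=.
- exact/right_averageD/left_averageD.
- apply: right_average_linl; exact: left_average_linear.
- apply: right_average_linear; first exact: left_averageD.
  by move=> b y; apply: left_average_linr => z; apply: hr.
Qed.

Definition average (h : endo f) : endo j :=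
  exist (fun h => h \in endo_pred j) _ (average_endo h).

Lemma restrict_endo (h : endo j) : val h \in endo_pred f.
Proof.
case: h => h /= /endo_predP[hD hl hr].
by apply/endo_predP; split=> [//|b x|x b] /=; rewrite fE ?hl ?hr.
Qed.

Definition restrict (h : endo j) : endo f :=
  exist (fun h => h \in endo_pred f) _ (restrict_endo h).

(** Scalars r_i on the left meet the factors u_k of the left average, which is why
they have to commute with W. *)
Lemma left_average_suml (n : nat) (r : 'I_n -> A) (h : 'I_n -> A -> A) :
    (forall i w, r i * j w = j w * r i) ->
  left_average (fun x => \sum_i r i * h i x) =
    fun x => \sum_i r i * left_average (h i) x.
Proof.
move=> rC; apply/funext=> x; rewrite /left_average.
under eq_bigr do rewrite mulr_sumr.
rewrite exchange_big; apply: eq_bigr => i _; rewrite mulr_sumr.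
by apply: eq_bigr => p _; rewrite !mulrA rC.
Qed.

Lemma right_average_suml (n : nat) (r : 'I_n -> A) (h : 'I_n -> A -> A) :
  right_average (fun x => \sum_i r i * h i x) =
    fun x => \sum_i r i * right_average (h i) x.
Proof.
apply/funext=> x; rewrite /right_average.
under eq_bigr do rewrite mulr_suml.
rewrite exchange_big; apply: eq_bigr => i _; rewrite mulr_sumr.
by apply: eq_bigr => p _; rewrite !mulrA.
Qed.

Lemma left_average_sumr (n : nat) (r : 'I_n -> A) (h : 'I_n -> A -> A) :
  left_average (fun x => \sum_i h i x * r i) =
    fun x => \sum_i left_average (h i) x * r i.
Proof.
apply/funext=> x; rewrite /left_average.
under eq_bigr do rewrite mulr_sumr.
rewrite exchange_big; apply: eq_bigr => i _; rewrite mulr_suml.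
by apply: eq_bigr => p _; rewrite !mulrA.
Qed.

Lemma right_average_sumr (n : nat) (r : 'I_n -> A) (h : 'I_n -> A -> A) :
    (forall i w, r i * j w = j w * r i) ->
  right_average (fun x => \sum_i h i x * r i) =
    fun x => \sum_i right_average (h i) x * r i.
Proof.
move=> rC; apply/funext=> x; rewrite /right_average.
under eq_bigr do rewrite mulr_suml.
rewrite exchange_big; apply: eq_bigr => i _; rewrite mulr_suml.
by apply: eq_bigr => p _; rewrite -!mulrA rC.
Qed.

Lemma average_restrict (h : endo j) : average (restrict h) = h.
Proof.
apply/val_inj; rewrite /=; case: h => h /= /endo_predP[_ hl hr].
by rewrite left_average_id ?right_average_id // => w x; apply: hr.
Qed.

(** Since averaging fixes h, it turns an expansion of h over the endomorphisms
beta_i of A | B into one over endomorphisms of A | W with the same scalars. *)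
Lemma average_expansionl (n : nat) (r : 'I_n -> A) (beta : 'I_n -> endo f)
    (h : endo j) :
    (forall i w, r i * j w = j w * r i) ->
    (forall x, val h x = \sum_i r i * val (beta i) x) ->
  forall x, val h x = \sum_i r i * val (average (beta i)) x.
Proof.
move=> rC hE x; rewrite -{1}(average_restrict h) /=.
by rewrite (funext hE) left_average_suml // right_average_suml.
Qed.

Lemma average_expansionr (n : nat) (r : 'I_n -> A) (beta : 'I_n -> endo f)
    (h : endo j) :
    (forall i w, r i * j w = j w * r i) ->
    (forall x, val h x = \sum_i val (beta i) x * r i) ->
  forall x, val h x = \sum_i val (average (beta i)) x * r i.
Proof.
move=> rC hE x; rewrite -{1}(average_restrict h) /=.
by rewrite (funext hE) left_average_sumr right_average_sumr.
Qed.

Definition tens_proj : AxA f -> AxA j :=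
  @tens_lift _ _ _ (bimod_AB f) (bimod_BA f) (AxA j) (mk j).

Lemma balanced_mk : @balanced _ _ _ (bimod_AB f) (bimod_BA f) (AxA j) (mk j).
Proof.
split=> [x x' y|x y y'|x b y]; first exact: mkDl.
  exact: mkDr.
by rewrite /= fE mkA.
Qed.

Lemma tens_proj_mk x y : tens_proj (mk f x y) = mk j x y.
Proof. exact: tens_liftE balanced_mk _ _. Qed.

Lemma tens_projD z z' : tens_proj (z + z') = tens_proj z + tens_proj z'.
Proof. exact: tens_liftD balanced_mk _ _. Qed.

Lemma tens_proj_lact a z : tens_proj (lact a z) = lact a (tens_proj z).
Proof.
move: z; apply: AxA_ext => [z z'|z z'|x y]; rewrite ?lactDr ?tens_projD ?lactDr //.
by rewrite lact_mk !tens_proj_mk lact_mk.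
Qed.

Lemma tens_proj_ract a z : tens_proj (ract z a) = ract (tens_proj z) a.
Proof.
move: z; apply: AxA_ext => [z z'|z z'|x y]; rewrite ?ractDl ?tens_projD ?ractDl //.
by rewrite ract_mk !tens_proj_mk ract_mk.
Qed.

(** Compatibility of the two maps Psi along A (x)_B A -> A (x)_W A, so that the
coordinates of h are the same seen over W or over B. *)
Lemma PsiL_tens_proj z (h : endo j) :
  homL_fun (PsiL (tens_proj z)) h = homL_fun (PsiL z) (restrict h).
Proof.
have [Dj _ _] := PsiL_hom j; have [Df _ _] := PsiL_hom f.
move: z; apply: AxA_ext => [z z'|z z'|x y].
- by rewrite tens_projD [PsiL _]Dj.
- by rewrite [PsiL _]Df.
- by rewrite tens_proj_mk !PsiLE.
Qed.

Lemma PsiR_tens_proj z (h : endo j) :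
  homR_fun (PsiR (tens_proj z)) h = homR_fun (PsiR z) (restrict h).
Proof.
have [Dj _ _] := PsiR_hom j; have [Df _ _] := PsiR_hom f.
move: z; apply: AxA_ext => [z z'|z z'|x y].
- by rewrite tens_projD [PsiR _]Dj.
- by rewrite [PsiR _]Df.
- by rewrite tens_proj_mk !PsiRE.
Qed.

Definition tens_average (t : AxA f) : AxA j :=
  \sum_(p <- e) ract (lact (j p.1) (tens_proj t)) (j p.2).

(** Apply the Casimir identity to (u, v) |-> u t v, which is balanced over B
because t is B-central. *)
Lemma tens_average_central t : base_central t -> base_central (tens_average t).
Proof.
move=> tC w; have [_ eC] := eP; rewrite /tens_average.
pose phi (u v : W) : AxA j := ract (lact (j u) (tens_proj t)) (j v).
have /eC/(_ w) : @balanced _ _ _ (bimod_AB g) (bimod_BA g) (AxA j) phi.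
  split=> [x x' y|x y y'|x b y].
  - rewrite -[LHS]/(phi ((x : W) + x') y) /phi.
    by rewrite rmorphD lactDl ractDl.
  - rewrite -[LHS]/(phi x ((y : W) + y')) /phi.
    by rewrite rmorphD ractDr.
  - rewrite -[LHS]/(phi (x * g b) y) -[RHS]/(phi x (g b * y)) /phi !rmorphM.
    by rewrite -lactA -fE -tens_proj_lact tC tens_proj_ract lractA ractA.
rewrite /phi lact_sum ract_sum => E.
under eq_bigr do rewrite lractA lactA -rmorphM.
by rewrite E; apply: eq_bigr => p _; rewrite rmorphM ractA.
Qed.

(** W-linearity of h gives Psi(sum_k u_k t v_k)(h) = sum_k u_k r v_k for
r = Psi(t)(h); when r commutes with W this is r sum_k u_k v_k = r. *)
Lemma PsiL_tens_average t (h : endo j) :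
    (forall w, homL_fun (PsiL t) (restrict h) * j w =
               j w * homL_fun (PsiL t) (restrict h)) ->
  homL_fun (PsiL (tens_average t)) h = homL_fun (PsiL t) (restrict h).
Proof.
move=> tC; rewrite /tens_average PsiL_sum.
under eq_bigr do rewrite PsiL_ract PsiL_lact PsiL_tens_proj -tC -mulrA.
by rewrite -mulr_sumr casimir_mul mulr1.
Qed.

Lemma PsiR_tens_average t (h : endo j) :
    (forall w, homR_fun (PsiR t) (restrict h) * j w =
               j w * homR_fun (PsiR t) (restrict h)) ->
  homR_fun (PsiR (tens_average t)) h = homR_fun (PsiR t) (restrict h).
Proof.
move=> tC; rewrite /tens_average PsiR_sum.
under eq_bigr do rewrite PsiR_ract PsiR_lact PsiR_tens_proj -tC -mulrA.
by rewrite -mulr_sumr casimir_mul mulr1.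
Qed.

End Tower.

(** * Weak depth two over an intermediate separable extension *)

Section WeakD2.
Context (B W A : pzRingType) (g : {rmorphism B -> W}) (j : {rmorphism W -> A}).
Context (f : {rmorphism B -> A}) (fE : forall b, f b = j (g b)).
Context (cent_range : centralizer (range f) `<=` centralizer (range j)).

Lemma cent_pred_comm a :
  a \in cent_pred (range f) -> forall w, a * j w = j w * a.
Proof. by move=> /cent_predP/cent_range aC w; apply: aC; exists w. Qed.

(** The averages of a quasi-basis of A | B satisfy the hypotheses of
[weak_left_D2_of_quasi_basis] for A | W. *)
Lemma weak_left_D2_of_separable :
  separable_ext g -> left_D2 f -> weak_left_D2 j.
Proof.
case/separable_casimir=> e eP /left_D2_quasi_basis[n [t [beta [tC tE]]]].
have rC i (h : endo j) := cent_pred_comm (PsiL_cent (restrict fE h) (tC i)).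
apply: (@weak_left_D2_of_quasi_basis _ _ j n
  (fun i => tens_average j e (t i)) (fun i => average fE eP (beta i))).
  by move=> i; apply: tens_average_central eP _ _.
move=> h x; under eq_bigr do rewrite (PsiL_tens_average eP) //.
apply: average_expansionl => // {}x.
(* h x = h(x) 1 is the value of Psi at x (x) 1, expanded in the quasi-basis. *)
have <- : homL_fun (PsiL (mk f x 1)) (restrict fE h) = val h x.
  by rewrite PsiLE mulr1.
rewrite tE PsiL_sum; apply: eq_bigr => i _.
by rewrite PsiL_ract mulr1.
Qed.

Lemma weak_right_D2_of_separable :
  separable_ext g -> right_D2 f -> weak_right_D2 j.
Proof.
case/separable_casimir=> e eP /right_D2_quasi_basis[n [t [beta [tC tE]]]].
have rC i (h : endo j) := cent_pred_comm (PsiR_cent (restrict fE h) (tC i)).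
apply: (@weak_right_D2_of_quasi_basis _ _ j n
  (fun i => tens_average j e (t i)) (fun i => average fE eP (beta i))).
  by move=> i; apply: tens_average_central eP _ _.
move=> h x; under eq_bigr do rewrite (PsiR_tens_average eP) //.
apply: average_expansionr => // {}x.
have <- : homR_fun (PsiR (mk f 1 x)) (restrict fE h) = val h x.
  by rewrite PsiRE mul1r.
rewrite tE PsiR_sum; apply: eq_bigr => i _.
by rewrite PsiR_lact mul1r.
Qed.

End WeakD2.

Lemma centralizer_double_cent (B A : pzRingType) (f : {rmorphism B -> A}) :
  centralizer (range f) `<=` centralizer (range (ext_AW f)).
Proof.
move=> a aC _ [[w wC] _ <-] /=.
by apply/esym; move/cent_predP: wC; apply.
Qed.

Theorem theorem2p3 (K : comPzRingType) (A B : algebra K)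
    (f : {rmorphism B -> A}) (f_alg : alg_hom f) :
  (left_D2 f -> separable_ext (ext_WB f) -> weak_left_D2 (ext_AW f)) /\
  (right_D2 f -> separable_ext (ext_WB f) -> weak_right_D2 (ext_AW f)).
Proof.
have fE b : f b = ext_AW f (ext_WB f b) by [].
have sub := @centralizer_double_cent _ _ f.
split=> fD2 gsep; first exact: (weak_left_D2_of_separable fE sub gsep fD2).
exact: (weak_right_D2_of_separable fE sub gsep fD2).
Qed.
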